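(* For every cycle (on $n\ge 3$ vertices), the starting position of Proper $2$-coloring on that cycle is a $\mathcal{P}$-position.
   Context: Proper $2$-coloring on a graph: two players alternate; a move chooses one uncolored vertex and assigns it one of two colors so that no two adjacent vertices have the same color. Both players may use both colors. Colored vertices are never recolored. The player unable to move loses. The starting position is the one with all vertices uncolored. A position is a $\mathcal{P}$-position if the second player (the one not about to move) has a winning strategy, and an $\mathcal{N}$-position otherwise. *)

(* Defs.v *)
From mathcomp Require Import all_boot.

Set Implicit Arguments.
Unset Strict Implicit.
Unset Printing Implicit Defensive.

Section ProperTwoColoring.

(* A graph is given by its adjacency relation on a finite type of vertices. *)
Variables (T : finType) (adj : rel T).

(* [None] marks an uncolored vertex; the two colors are the booleans. *)
Definition position : finType := {ffun T -> option bool}.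

Definition start : position := [ffun=> None].

Definition proper (p : position) : bool :=
  [forall v, forall w, adj v w ==> (p v != None) ==> (p v != p w)].

Definition color_vertex (p : position) (v : T) (c : bool) : position :=
  [ffun w => if w == v then Some c else p w].

Definition move : rel position := fun p q =>
  [exists v, exists c,
    [&& p v == None, q == color_vertex p v c & proper q]].

Definition terminal (p : position) : bool := ~~ [exists q, move p q].

(* Legality prevents a player from escaping defeat by refusing to move. *)
Definition legal_strategy (sigma : position -> position) : Prop :=
  forall p, ~~ terminal p -> move p (sigma p).

(* In the play p, s_0, s_1, ... the second player makes the moves leading to
   s_i with i odd. *)
Definition second_follows (sigma : position -> position)
    (p : position) (s : seq position) : Prop :=
  forall i, i < size s -> odd i -> nth p s i = sigma (nth p (p :: s) i).

(* After an even number of moves the first player is to move, hence loses if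
   the position reached is terminal. Every sequence of moves is finite, so
   infinite plays need no separate treatment. *)
Definition second_wins_with (sigma : position -> position)
    (p : position) : Prop :=
  forall s : seq position,
    path move p s -> second_follows sigma p s -> terminal (last p s) ->
    ~~ odd (size s).

Definition P_position (p : position) : Prop :=
  exists sigma, legal_strategy sigma /\ second_wins_with sigma p.

End ProperTwoColoring.

Arguments start : clear implicits.

(* [ordS] is the successor modulo n. *)
Definition cycle_adj (n : nat) : rel 'I_n :=
  fun i j => (j == ordS i) || (i == ordS j).

Lemma cycle_adj_sym n : symmetric (@cycle_adj n).
Proof. by move=> i j; rewrite /cycle_adj orbC. Qed.

Lemma cycle_adj_irrefl n : 1 < n -> irreflexive (@cycle_adj n).
Proof.
move=> n_gt1 i; rewrite /cycle_adj orbb; apply/negbTE/eqP => /(congr1 val) /=.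
case: i => i lt_in /=; move: (lt_in); rewrite leq_eqVlt => /predU1P[e|lt] h.
  by move: n_gt1; rewrite -e h e modnn ltnn.
by move: h; rewrite modn_small // => /eqP; rewrite ltn_eqF.
Qed.

(* Main.v *)
Require Import Defs.
From mathcomp Require Import all_boot.

(** On a cycle the outcome does not depend on how the game is played: every
    complete play has even length, so the player who starts always runs out of
    moves first.

    A play of length k colors k vertices, so it suffices that a proper terminal
    position has evenly many colored vertices. In such a position an uncolored
    vertex sees both colors ([terminal_sees_color]), so both its neighbors are
    colored, and differently. Hence, going around the cycle from a colored
    vertex, the next colored vertex is one or two steps away and always has the
    opposite color ([next_colored_flip]). This next-vertex map injects each
    color class into the other, so the two classes have the same size and
    together contain an even number of vertices. *)

Set Implicit Arguments.
Unset Strict Implicit.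
Unset Printing Implicit Defensive.

Section AnyGraph.

Variables (T : finType) (adj : rel T).
Implicit Types (p q : position T) (s : seq (position T)).

Definition colored p : {set T} := [set v | p v != None].

Definition color_class p (c : bool) : {set T} := [set v | p v == Some c].

Lemma card_colored p :
  #|colored p| = #|color_class p true| + #|color_class p false|.
Proof.
rewrite -cardsUI; have ->: color_class p true :&: color_class p false = set0.
  by apply/setP=> v; rewrite !inE; case: (p v) => [[]|].
rewrite cards0 addn0; apply: eq_card => v; rewrite !inE.
by case: (p v) => [[]|].
Qed.

Lemma move_colored p q : move adj p q -> #|colored q| = #|colored p|.+1.
Proof.
case/existsP=> v /existsP[c /and3P[/eqP pv /eqP-> _]].
have ->: colored (color_vertex p v c) = v |: colored p.
  by apply/setP=> w; rewrite !inE ffunE; case: (w == v).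
by rewrite cardsU1 inE pv.
Qed.

Lemma proper_start : Defs.proper adj (start T).
Proof.
by apply/forallP=> v; apply/forallP=> w; rewrite ffunE implybT.
Qed.

Lemma path_move_colored p s :
  Defs.proper adj p -> path (move adj) p s ->
  Defs.proper adj (last p s) /\ #|colored (last p s)| = #|colored p| + size s.
Proof.
elim: s p => [|q s IHs] p /= p_ok; first by rewrite addn0.
case/andP=> pq /IHs[|q_ok ->].
  by case/existsP: pq => v /existsP[c /and3P[]].
by rewrite (move_colored pq) addSnnS.
Qed.

(** When the parity of the number of colored vertices is forced at the end of
    the game, any legal strategy wins. *)
Lemma P_position_even_terminal :
  (forall p, Defs.proper adj p -> terminal adj p -> ~~ odd #|colored p|) ->
  P_position adj (start T).
Proof.
move=> even_end; exists (fun p => odflt p [pick q | move adj p q]); split.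
  move=> p; rewrite negbK => /existsP[q pq].
  by case: pickP => // /(_ q); rewrite pq.
move=> s ps _ end_s; have [s_ok] := path_move_colored proper_start ps.
have ->: colored (start T) = set0 by apply/setP=> v; rewrite !inE ffunE.
by rewrite cards0 add0n => <-; apply: even_end.
Qed.

(** Otherwise this vertex could still be given the color [c]. *)
Lemma terminal_sees_color p v c :
  symmetric adj -> irreflexive adj -> Defs.proper adj p -> terminal adj p ->
  p v = None -> exists2 w, adj v w & p w = Some c.
Proof.
move=> adjC adjxx p_ok p_end pv.
case: (pickP [pred w | adj v w && (p w == Some c)]) => [w|no_c] /=.
  by case/andP=> vw /eqP; exists w.
case/negP: p_end; apply/existsP; exists (color_vertex p v c).
apply/existsP; exists v; apply/existsP; exists c; rewrite pv !eqxx /=.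
apply/forallP=> x; apply/forallP=> y; rewrite !ffunE.
apply/implyP=> xy; apply/implyP.
have [xv|_] := eqVneq x v; have [yv|_] := eqVneq y v.
- by move: xy; rewrite xv yv adjxx.
- by move=> _; move: (no_c y); rewrite /= -xv xy /= eq_sym => ->.
- by move=> _; move: (no_c x); rewrite /= -yv adjC xy /= => ->.
by move/forallP: p_ok => /(_ x)/forallP/(_ y); rewrite xy /= => /implyP.
Qed.

End AnyGraph.

Section Cycle.

Variable n : nat.
Implicit Type p : position 'I_n.

(** Two steps suffice, because a terminal position has no two adjacent
    uncolored vertices. *)
Definition next_colored p (v : 'I_n) : 'I_n :=
  if p (ordS v) == None then ordS (ordS v) else ordS v.

(** Were one vertex reached in one step from [v] and in two from [w], then [v]
    would be the vertex skipped after [w], which is uncolored. *)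
Lemma next_colored_inj p : {in colored p &, injective (next_colored p)}.
Proof.
move=> v w; rewrite !inE /next_colored => pv pw.
case: eqP => [v1|_]; case: eqP => [w1|_] => /(can_inj (@ordSK n)).
- by move/(can_inj (@ordSK n)).
- by move=> e; rewrite -e v1 in pw.
- by move=> e; rewrite e w1 in pv.
by [].
Qed.

Lemma next_colored_flip p v c :
  1 < n -> Defs.proper (@cycle_adj n) p -> terminal (@cycle_adj n) p ->
  p v = Some c -> p (next_colored p v) = Some (~~ c).
Proof.
move=> n_gt1 p_ok p_end pv; rewrite /next_colored; case: eqP => [v1|].
  have [w] := terminal_sees_color (~~ c) (@cycle_adj_sym n)
    (cycle_adj_irrefl n_gt1) p_ok p_end v1.
  case/orP=> [/eqP-> //|/eqP/(can_inj (@ordSK n)) <-].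
  by rewrite pv; case: (c).
move/forallP: p_ok => /(_ v)/forallP/(_ (ordS v)).
rewrite /cycle_adj eqxx pv /=.
by case: (p (ordS v)) => // -[]; case: (c).
Qed.

Lemma leq_color_class p c :
  1 < n -> Defs.proper (@cycle_adj n) p -> terminal (@cycle_adj n) p ->
  #|color_class p c| <= #|color_class p (~~ c)|.
Proof.
move=> n_gt1 p_ok p_end.
rewrite -(card_in_imset (f := next_colored p)) => [|v w]; last first.
  rewrite !inE => /eqP pv /eqP pw.
  by apply: next_colored_inj; rewrite inE ?pv ?pw.
apply/subset_leq_card/subsetP=> _ /imsetP[v + ->]; rewrite !inE => /eqP pv.
by rewrite (next_colored_flip n_gt1 p_ok p_end pv).
Qed.

Lemma even_colored_terminal p :
  1 < n -> Defs.proper (@cycle_adj n) p -> terminal (@cycle_adj n) p ->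
  ~~ odd #|colored p|.
Proof.
move=> n_gt1 p_ok p_end; rewrite card_colored.
have ->: #|color_class p true| = #|color_class p false|.
  by apply/eqP; rewrite eqn_leq (leq_color_class true) ?(leq_color_class false).
by rewrite addnn odd_double.
Qed.

End Cycle.

Theorem corollary5 (n : nat) (hn : 3 <= n) :
  P_position (@cycle_adj n) (start 'I_n).
Proof.
apply: P_position_even_terminal => p.
exact: even_colored_terminal (ltnW hn).
Qed.
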